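(* Let $k_x,k_y\in\mathbb{C}$ and let $(\mathcal{A}_{\mathrm{ev}},\mathcal{H},D;J)$, with $\mathcal{A}_{\mathrm{ev}}=\mathbb{C}_R\oplus\mathbb{C}_L\oplus M_2(\mathbb{C})$, be the finite real spectral triple described in the context. Let $A=\sum_j a_j\delta(b_j)$ be a self-adjoint universal one-form over $\mathcal{A}_{\mathrm{ev}}$, with $a_j=(\lambda'_{Rj},\lambda'_{Lj},m'_j)$ and $b_j=(\lambda_{Rj},\lambda_{Lj},m_j)$. The inner fluctuated Dirac operator $D'(A)=D+A_{(1)}+JA_{(1)}J^{-1}+A_{(2)}$ is parametrized by the three complex scalars $$\phi=\sum_j\lambda'_{Rj}(\lambda_{Lj}-\lambda_{Rj}),\qquad \sigma_I=\sum_j\Big((m'_j)_{I1}\lambda_{Rj}-\sum_{K=1}^2(m'_j)_{IK}(m_j)_{K1}\Big)\quad(I=1,2),$$ which enter in $A_{(1)}$ and $A_{(2)}$. Namely, writing $D'(A)$ in block form with respect to unprimed indices $(\alpha,I)$ and primed indices $(\alpha',I')$, its blocks are $$D'(A)_{\alpha I}^{\beta J}=\left(\delta_\alpha^1\delta^\beta_2\,k_x(1+\phi)+\delta_\alpha^2\delta^\beta_1\,\overline{k_x}(1+\overline\phi)\right)\delta_I^J,$$ $$D'(A)_{\alpha' I'}^{\beta J}=\delta_{\alpha'}^1\delta^\beta_1\,(\delta_{I'}^1+\sigma_{I'})(\delta^J_1+\sigma^J)\,k_y,$$ where $\sigma^J=\sigma_J$, and the remaining two blocks are the entrywise complex conjugates: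 $D'(A)_{\alpha' I'}^{\beta' J'}=\overline{D'(A)_{\alpha I}^{\beta J}}$ and $D'(A)_{\alpha I}^{\beta' J'}=\overline{D'(A)_{\alpha' I'}^{\beta J}}$.
   Context: $\mathcal{H}=(\mathbb{C}^2\otimes\mathbb{C}^2)\oplus(\mathbb{C}^2\otimes\mathbb{C}^2)$, first summand indexed by pairs $(\alpha,I)$, second by primed pairs $(\alpha',I')$, all indices in $\{1,2\}$; for an operator $T$, $T_{A}^{B}$ denotes the matrix entry with row index $A$ and column index $B$, and for a $2\times 2$ matrix $m$, $m_{IK}$ is the entry in row $I$, column $K$. Operators are written as $2\times2$ block matrices; $e_{ij}$ are matrix units of $M_2(\mathbb{C})$, and in $S\otimes T$ the factor $S$ acts on $\alpha$ (or $\alpha'$), $T$ on $I$ (or $I'$). The algebra $\mathcal{A}_{\mathrm{ev}}$ ($\mathbb{C}_R,\mathbb{C}_L$ are copies of $\mathbb{C}$) acts by $$\pi(\lambda_R,\lambda_L,m)=\begin{pmatrix}X\otimes1&0\\0&1\otimes m\end{pmatrix},\qquad X=\begin{pmatrix}\lambda_R&0\\0&\lambda_L\end{pmatrix}.$$ The real structure is $J(\psi,\psi')=(\overline{\psi'},\overline\psi)$ (exchange of the summands and complex conjugation). The Dirac operator is $$D=\begin{pmatrix}(k_xe_{12}+\overline{k_x}e_{21})\otimes1&\overline{k_y}\,e_{11}\otimes e_{11}\\ k_y\,e_{11}\otimes e_{11}&(\overline{k_x}e_{12}+k_xe_{21})\otimes1\end{pmatrix},$$ so that $JDJ^{-1}=D$.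 This triple need not satisfy the first-order condition. Universal one-forms over $\mathcal{A}_{\mathrm{ev}}$ are finite sums $A=\sum_j a_j\delta(b_j)$, with $\delta$ the universal derivation and involution satisfying $\delta(x)^*=-\delta(x^* )$; $A$ is self-adjoint if $A^*=A$. Identifying $a\in\mathcal{A}_{\mathrm{ev}}$ with $\pi(a)$, put $$A_{(1)}=\sum_j a_j[D,b_j],\qquad A_{(2)}=\sum_j a_j[JA_{(1)}J^{-1},b_j].$$ *)

(* Defs.v *)
From HB Require Import structures.
From mathcomp Require Import all_boot all_order all_algebra.
From mathcomp Require Import reals complex mxtens.

Set Implicit Arguments.
Unset Strict Implicit.
Unset Printing Implicit Defensive.

Import GRing.Theory Num.Theory.
Local Open Scope ring_scope.

(* The indices 1, 2 are the elements 0, 1 of 'I_2; C will be R[i] for a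
   realType R.  S *t T is the Kronecker product, modelling S (x) T. *)

Section FiniteTriple.
Variable C : numClosedFieldType.

(* C_R (+) C_L (+) M_2(C) with componentwise operations; an element is
   (lambda_R, lambda_L, m).  C^o is C seen as a module over itself. *)
Definition Aev := (C^o * C^o * 'M[C]_2)%type.

Definition lamR (a : Aev) : C := a.1.1.
Definition lamL (a : Aev) : C := a.1.2.
Definition mpart (a : Aev) : 'M[C]_2 := a.2.

Definition Astar (a : Aev) : Aev :=
  ((lamR a)^*, (lamL a)^*, map_mx Num.conj (mpart a)^T).

(* Universal one-forms.  The space 'M_d with d = dim Aev is a model of
   Aev (x)_C Aev: the matrix t stands for the tensor
   \sum_(i, j) t i j *: (e_i (x) e_j) in a fixed basis e of Aev.  Universal
   one-forms live in the kernel of the multiplication map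
   Aev (x) Aev -> Aev, with delta b = 1 (x) b - b (x) 1. *)

Definition Abasis := vbasis {: Aev}.
Definition Atens := 'M[C]_(\dim {: Aev}).

Definition tens (x y : Aev) : Atens :=
  \matrix_(i, j) (coord Abasis i x * coord Abasis j y).

Definition lact (a : Aev) (t : Atens) : Atens :=
  \sum_i \sum_j t i j *: tens (a * Abasis`_i) Abasis`_j.

Definition ract (t : Atens) (a : Aev) : Atens :=
  \sum_i \sum_j t i j *: tens Abasis`_i (Abasis`_j * a).

Definition delta (b : Aev) : Atens := tens 1 b - tens b 1.

(* The antilinear extension of x (x) y |-> y^* (x) x^*; it is the involution
   with delta(x)^* = - delta(x^* ), see Tstar_delta and Tstar_lact. *)
Definition Tstar (t : Atens) : Atens :=
  \sum_i \sum_j (t i j)^* *: tens (Astar Abasis`_j) (Astar Abasis`_i).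

Lemma tens_basis (i j : 'I_(\dim {: Aev})) :
  tens Abasis`_i Abasis`_j = delta_mx i j.
Proof.
have fb : free Abasis by exact: (basis_free (vbasisP _)).
apply/matrixP=> k l; rewrite !mxE !coord_free // -natrM mulnb.
by rewrite (eq_sym k) (eq_sym l).
Qed.

Lemma Abasis_expand x : x = \sum_i coord Abasis i x *: Abasis`_i.
Proof. by apply: coord_vbasis; rewrite memvf. Qed.

Lemma tens_suml I (r : seq I) (c : I -> C) (F : I -> Aev) y :
  tens (\sum_(i <- r) c i *: F i) y = \sum_(i <- r) c i *: tens (F i) y.
Proof.
apply/matrixP=> k l; rewrite mxE linear_sum mulr_suml summxE.
by apply: eq_bigr => i _; rewrite !mxE linearZ /= mulrA.
Qed.

Lemma tens_sumr I (r : seq I) (c : I -> C) (F : I -> Aev) x :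
  tens x (\sum_(i <- r) c i *: F i) = \sum_(i <- r) c i *: tens x (F i).
Proof.
apply/matrixP=> k l; rewrite mxE linear_sum mulr_sumr summxE.
by apply: eq_bigr => i _; rewrite !mxE linearZ /= mulrCA.
Qed.

Lemma lact_tens a x y : lact a (tens x y) = tens (a * x) y.
Proof.
rewrite {2}(Abasis_expand x) mulr_sumr.
under eq_bigr => i _ do rewrite -scalerAr.
rewrite tens_suml; apply: eq_bigr => i _.
rewrite {2}(Abasis_expand y) tens_sumr scaler_sumr.
by apply: eq_bigr => j _; rewrite scalerA mxE.
Qed.

Lemma ract_tens a x y : ract (tens x y) a = tens x (y * a).
Proof.
rewrite {2}(Abasis_expand x) tens_suml; apply: eq_bigr => i _.
rewrite {2}(Abasis_expand y) mulr_suml.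
under [in RHS]eq_bigr => j _ do rewrite -scalerAl.
rewrite tens_sumr scaler_sumr.
by apply: eq_bigr => j _; rewrite scalerA mxE.
Qed.

Lemma Astar_sum I (r : seq I) (c : I -> C) (F : I -> Aev) :
  Astar (\sum_(i <- r) c i *: F i) = \sum_(i <- r) (c i)^* *: Astar (F i).
Proof.
elim: r => [|i r IHr].
  rewrite !big_nil /Astar /= /lamR /lamL /= !rmorph0.
  by congr (_, _, _); apply/matrixP=> k l; rewrite !mxE rmorph0.
rewrite !big_cons -IHr /Astar /lamR /lamL /mpart /= !rmorphD !rmorphM.
by congr (_, _, _); apply/matrixP=> k l; rewrite !mxE rmorphD rmorphM.
Qed.

Lemma Tstar_tens x y : Tstar (tens x y) = tens (Astar y) (Astar x).
Proof.
rewrite {2}(Abasis_expand x) Astar_sum tens_sumr; apply: eq_bigr => i _.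
rewrite {2}(Abasis_expand y) Astar_sum tens_suml scaler_sumr.
by apply: eq_bigr => j _; rewrite scalerA mxE rmorphM.
Qed.

Lemma AstarM x y : Astar (x * y) = Astar y * Astar x.
Proof.
rewrite /Astar /lamR /lamL /mpart /= !rmorphM.
congr (_, _, _); [exact: mulrC | exact: mulrC |].
apply/matrixP=> k l; rewrite !mxE rmorph_sum; apply: eq_bigr => i _.
by rewrite !mxE rmorphM mulrC.
Qed.

Lemma Astar1 : Astar 1 = 1.
Proof.
rewrite /Astar /lamR /lamL /mpart /= !rmorph1; congr (_, _, _).
by rewrite trmx1 map_mx1.
Qed.

Lemma ractB t u a : ract (t - u) a = ract t a - ract u a.
Proof.
rewrite /ract -sumrB; apply: eq_bigr => i _; rewrite -sumrB.
by apply: eq_bigr => j _; rewrite !mxE scalerBl.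
Qed.

Lemma lactB a t u : lact a (t - u) = lact a t - lact a u.
Proof.
rewrite /lact -sumrB; apply: eq_bigr => i _; rewrite -sumrB.
by apply: eq_bigr => j _; rewrite !mxE scalerBl.
Qed.

Lemma TstarB t u : Tstar (t - u) = Tstar t - Tstar u.
Proof.
rewrite /Tstar -sumrB; apply: eq_bigr => i _; rewrite -sumrB.
by apply: eq_bigr => j _; rewrite !mxE rmorphB scalerBl.
Qed.

Lemma deltaM x y : delta (x * y) = ract (delta x) y + lact x (delta y).
Proof.
by rewrite /delta ractB lactB !ract_tens !lact_tens mulr1 mul1r addrA subrK.
Qed.

Lemma Tstar_delta x : Tstar (delta x) = - delta (Astar x).
Proof. by rewrite /delta TstarB !Tstar_tens Astar1 opprB. Qed.

Lemma Tstar_lact a b :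
  Tstar (lact a (delta b)) = ract (Tstar (delta b)) (Astar a).
Proof.
rewrite Tstar_delta /delta lactB TstarB !lact_tens !Tstar_tens opprB ractB.
by rewrite !ract_tens Astar1 !mulr1 mul1r AstarM.
Qed.

(* H = (C^2 (x) C^2) (+) (C^2 (x) C^2): in each summand the basis vector of
   index (alpha, I) is number mxtens_index (alpha, I). *)

Definition Hvec := 'cV[C]_(2 * 2 + 2 * 2).
Definition Hop := 'M[C]_(2 * 2 + 2 * 2).

Definition Xmx (a : Aev) : 'M[C]_2 :=
  lamR a *: delta_mx 0 0 + lamL a *: delta_mx 1 1.

Definition pirep (a : Aev) : Hop :=
  block_mx (Xmx a *t (1%:M : 'M[C]_2)) 0 0 ((1%:M : 'M[C]_2) *t mpart a).

Definition Jop (psi : Hvec) : Hvec :=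
  col_mx (map_mx Num.conj (dsubmx psi)) (map_mx Num.conj (usubmx psi)).

Lemma JopK : involutive Jop.
Proof.
move=> v; rewrite /Jop col_mxKu col_mxKd -!map_mx_comp /=.
rewrite -[RHS]vsubmxK.
by congr col_mx; apply/matrixP=> i j; rewrite !mxE /= conjCK.
Qed.

(* The matrix of the linear operator J T J^-1, where J^-1 = J by JopK. *)
Definition Jconj (T : Hop) : Hop :=
  \matrix_(i, j) (Jop (T *m Jop (delta_mx j 0))) i 0.

Lemma JopD u v : Jop (u + v) = Jop u + Jop v.
Proof. by rewrite /Jop add_col_mx -!map_mxD !linearD. Qed.

Lemma JopZ c v : Jop (c *: v) = c^* *: Jop v.
Proof. by rewrite /Jop scale_col_mx -!map_mxZ !linearZ. Qed.

Lemma JconjE (T : Hop) (v : Hvec) : Jconj T *m v = Jop (T *m Jop v).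
Proof.
have Jsum I (r : seq I) (F : I -> Hvec) :
    Jop (\sum_(i <- r) F i) = \sum_(i <- r) Jop (F i).
  elim: r => [|i r IHr]; last by rewrite !big_cons JopD IHr.
  rewrite !big_nil /Jop -[RHS]vsubmxK.
  by congr col_mx; apply/matrixP=> i j; rewrite !mxE rmorph0.
have -> : v = \sum_j v j 0 *: delta_mx j 0.
  by rewrite {1}[v]matrix_sum_delta; under eq_bigr do rewrite big_ord1.
rewrite Jsum !mulmx_sumr Jsum; apply: eq_bigr => j _.
rewrite JopZ -!scalemxAr JopZ conjCK; congr (_ *: _).
rewrite -colE; apply/colP=> i; by rewrite !mxE.
Qed.

Lemma Jconj_block (T : Hop) :
  Jconj T = block_mx (map_mx Num.conj (drsubmx T)) (map_mx Num.conj (dlsubmx T))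
                     (map_mx Num.conj (ursubmx T)) (map_mx Num.conj (ulsubmx T)).
Proof.
have mulconj m p (M : 'M[C]_(m, p)) (v : 'cV[C]_p) :
    map_mx Num.conj (M *m map_mx Num.conj v) = map_mx Num.conj M *m v.
  rewrite map_mxM; congr (_ *m _).
  by apply/matrixP=> i j; rewrite !mxE /= conjCK.
apply/row_matrixP=> i; apply/rowP=> j.
pose v : Hvec := delta_mx j 0.
have E M N : M *m v = N *m v -> row i M 0 j = row i N 0 j.
  by rewrite /v -!colE => /colP/(_ i); rewrite !mxE.
apply: E; rewrite JconjE -{1}[T]submxK -[in RHS](vsubmxK v) /Jop.
rewrite !mul_block_col col_mxKu col_mxKd !map_mxD !mulconj.
by congr col_mx; rewrite addrC.
Qed.

Definition dirac (kx ky : C) : Hop :=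
  block_mx
    ((kx *: delta_mx 0 1 + kx^* *: delta_mx 1 0) *t (1%:M : 'M[C]_2))
    (ky^* *: ((delta_mx 0 0 : 'M[C]_2) *t (delta_mx 0 0 : 'M[C]_2)))
    (ky *: ((delta_mx 0 0 : 'M[C]_2) *t (delta_mx 0 0 : 'M[C]_2)))
    ((kx^* *: delta_mx 0 1 + kx *: delta_mx 1 0) *t (1%:M : 'M[C]_2)).

Lemma JconjD kx ky : Jconj (dirac kx ky) = dirac kx ky.
Proof.
rewrite Jconj_block /dirac block_mxKul block_mxKur block_mxKdl block_mxKdr.
rewrite !map_mxZ !map_mxT !map_mxD !map_mxZ !map_mx1 !map_delta_mx /=.
by rewrite !conjCK.
Qed.

Definition commutator (S T : Hop) : Hop := S *m T - T *m S.

(* The one-form \sum_j a_j delta(b_j) is entered through the families a, b. *)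

Section Fluctuation.
Variables (kx ky : C) (n : nat) (a b : 'I_n -> Aev).

Definition A1 : Hop :=
  \sum_j pirep (a j) *m commutator (dirac kx ky) (pirep (b j)).

Definition A2 : Hop :=
  \sum_j pirep (a j) *m commutator (Jconj A1) (pirep (b j)).

Definition fluctuated_dirac : Hop := dirac kx ky + A1 + Jconj A1 + A2.

End Fluctuation.

(* Entries of the four blocks of T, row index pair first: U stands for the
   unprimed (first) summand, P for the primed (second) one. *)
Definition entryUU (T : Hop) (al I be J : 'I_2) : C :=
  ulsubmx T (mxtens_index (al, I)) (mxtens_index (be, J)).
Definition entryUP (T : Hop) (al I be J : 'I_2) : C :=
  ursubmx T (mxtens_index (al, I)) (mxtens_index (be, J)).
Definition entryPU (T : Hop) (al I be J : 'I_2) : C :=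
  dlsubmx T (mxtens_index (al, I)) (mxtens_index (be, J)).
Definition entryPP (T : Hop) (al I be J : 'I_2) : C :=
  drsubmx T (mxtens_index (al, I)) (mxtens_index (be, J)).

End FiniteTriple.

Definition kron {C : numClosedFieldType} (i j : 'I_2) : C := (i == j)%:R.

(* Main.v *)
(* Every operator occurring in D'(A) has the shape
     [p (x) 1, e_11 (x) q; e_11 (x) r, s (x) 1],
   and the map T |-> \sum_j a_j [T, b_j] sends it to
     [G(p) (x) 1, e_11 (x) q W; e_11 (x) V r, 0]
   with G(p) = \sum_j X_(a_j) [p, X_(b_j)], V = \sum_j m'_j (lambda_Rj - m_j)
   and W = \sum_j lambda'_Rj (m_j - lambda_Rj).  Hence the lower left block of
   D'(A) is k_y e_11 (x) (1 + V) e_11 (1 + conj W), which only involves the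
   first column sigma of V and the first row of W.  Pairing the identity
   A^* = A with tensor products of linear forms on A_ev identifies that row
   with the conjugate of sigma, and shows that
   \sum_j lambda'_Lj (lambda_Rj - lambda_Lj) is the conjugate of phi. *)
From HB Require Import structures.
Require Import Defs.
From mathcomp Require Import all_boot all_order all_algebra.
From mathcomp Require Import reals complex mxtens ring.

Import GRing.Theory Num.Theory.
Local Open Scope ring_scope.

(** * Linear forms on [Aev] and the scalar identities they extract from self-adjointness *)

Section SelfAdjointForms.
Context {C : numClosedFieldType}.
Implicit Types (f g : {scalar Aev C}) (x y : Aev C).

Fact lamR_is_scalar : scalar (@lamR C). Proof. by []. Qed.
HB.instance Definition _ :=
  GRing.isLinear.Build C (Aev C) C *%R (@lamR C) lamR_is_scalar.

Fact lamL_is_scalar : scalar (@lamL C). Proof. by []. Qed.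
HB.instance Definition _ :=
  GRing.isLinear.Build C (Aev C) C *%R (@lamL C) lamL_is_scalar.

Definition mentry (i j : 'I_2) x : C := mpart x i j.

Fact mentry_is_scalar i j : scalar (mentry i j).
Proof. by move=> c x y; rewrite /mentry /mpart /= !mxE. Qed.
HB.instance Definition _ i j :=
  GRing.isLinear.Build C (Aev C) C *%R (mentry i j) (mentry_is_scalar i j).

(** This is the functional [f] (x) [g] on Aev (x) Aev, written in the coordinates that [Atens] uses
    for tensors. *)
Definition tens_pairing f g (t : Atens C) : C :=
  \sum_i \sum_j t i j * (f (Abasis C)`_i * g (Abasis C)`_j).

Lemma tens_pairing_tens f g x y : tens_pairing f g (tens x y) = f x * g y.
Proof.
rewrite {2}(Abasis_expand x) {2}(Abasis_expand y) !linear_sum big_distrlr /=.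
apply: eq_bigr => i _; apply: eq_bigr => j _.
by rewrite mxE !linearZ /= mulrACA.
Qed.

Fact tens_pairing_is_zmod_morphism f g : zmod_morphism (tens_pairing f g).
Proof.
move=> t u; rewrite /tens_pairing -sumrB; apply: eq_bigr => i _.
by rewrite -sumrB; apply: eq_bigr => j _; rewrite !mxE mulrBl.
Qed.
HB.instance Definition _ f g :=
  GRing.isZmodMorphism.Build (Atens C) C (tens_pairing f g)
    (tens_pairing_is_zmod_morphism f g).

HB.instance Definition _ :=
  GRing.isZmodMorphism.Build (Atens C) (Atens C) (@Tstar C) (@TstarB C).

(** Expanding a delta(b) = a (x) b - ab (x) 1, the involution gives b^* (x) a^* - 1 (x) (ab)^*;
    applying [f] (x) [g] to both sides of A = A^* leaves an equation between scalars. *)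
Lemma selfadjoint_pairing f g {n} {a b : 'I_n -> Aev C} :
  let A := \sum_j lact (a j) (delta (b j)) in
  Tstar A = A ->
  \sum_j (f (a j) * g (b j) - f (a j * b j) * g 1) =
  \sum_j (f (Astar (b j)) * g (Astar (a j)) - f 1 * g (Astar (a j * b j))).
Proof.
have lactE j : lact (a j) (delta (b j)) = tens (a j) (b j) - tens (a j * b j) 1.
  by rewrite lactB !lact_tens mulr1.
rewrite /= (eq_bigr _ (fun j _ => lactE j)).
move=> /(congr1 (tens_pairing f g)).
rewrite (raddf_sum (@Tstar C)) !raddf_sum => E.
transitivity (\sum_j tens_pairing f g (tens (a j) (b j) - tens (a j * b j) 1)).
  by apply: eq_bigr => j _; rewrite raddfB /= !tens_pairing_tens.
rewrite -E; apply: eq_bigr => j _.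
by rewrite (raddfB (@Tstar C)) raddfB /= !Tstar_tens Astar1 !tens_pairing_tens.
Qed.

End SelfAdjointForms.

(** * Bilinearity of the Kronecker product *)

Section TensorBilinear.
Context {C : comPzRingType} {m n p q : nat}.

Lemma tensmxDl (S S' : 'M[C]_(m, n)) (T : 'M[C]_(p, q)) :
  (S + S') *t T = S *t T + S' *t T.
Proof. by apply/matrixP=> i j; rewrite !mxE mulrDl. Qed.

Lemma tensmxDr (S : 'M[C]_(m, n)) (T T' : 'M[C]_(p, q)) :
  S *t (T + T') = S *t T + S *t T'.
Proof. by apply/matrixP=> i j; rewrite !mxE mulrDr. Qed.

Lemma tensmxNl (S : 'M[C]_(m, n)) (T : 'M[C]_(p, q)) : (- S) *t T = - (S *t T).
Proof. by apply/matrixP=> i j; rewrite !mxE mulNr. Qed.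

Lemma tensmxNr (S : 'M[C]_(m, n)) (T : 'M[C]_(p, q)) : S *t (- T) = - (S *t T).
Proof. by apply/matrixP=> i j; rewrite !mxE mulrN. Qed.

Lemma tensmxZl c (S : 'M[C]_(m, n)) (T : 'M[C]_(p, q)) :
  (c *: S) *t T = c *: (S *t T).
Proof. by apply/matrixP=> i j; rewrite !mxE mulrA. Qed.

Lemma tensmxZr c (S : 'M[C]_(m, n)) (T : 'M[C]_(p, q)) :
  S *t (c *: T) = c *: (S *t T).
Proof. by apply/matrixP=> i j; rewrite !mxE mulrCA. Qed.

End TensorBilinear.

(** * Stability of the block shape under sums, [Jconj] and x [T, y] *)

Section BlockShape.
Context {C : numClosedFieldType}.
Implicit Types p q r s : 'M[C]_2.

Definition tens_block p q r s : Hop C :=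
  block_mx (p *t (1%:M : 'M_2)) ((delta_mx 0 0 : 'M_2) *t q)
           ((delta_mx 0 0 : 'M_2) *t r) (s *t (1%:M : 'M_2)).

Lemma tens_blockD p q r s p' q' r' s' :
  tens_block p q r s + tens_block p' q' r' s' =
  tens_block (p + p') (q + q') (r + r') (s + s').
Proof. by rewrite /tens_block add_block_mx -!tensmxDl -!tensmxDr. Qed.

Lemma tens_block_sum n (p q r s : 'I_n -> 'M[C]_2) :
  \sum_j tens_block (p j) (q j) (r j) (s j) =
  tens_block (\sum_j p j) (\sum_j q j) (\sum_j r j) (\sum_j s j).
Proof.
have tens_block0 : 0 = tens_block 0 0 0 0.
  by rewrite /tens_block !tens0mx !tensmx0 -block_mx0.
elim: n p q r s => [|n IHn] p q r s; first by rewrite !big_ord0.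
by rewrite !big_ord_recl IHn tens_blockD.
Qed.

Lemma diracE (kx ky : C) :
  dirac kx ky = tens_block (kx *: delta_mx 0 1 + kx^* *: delta_mx 1 0)
    (ky^* *: delta_mx 0 0) (ky *: delta_mx 0 0)
    (map_mx Num.conj (kx *: delta_mx 0 1 + kx^* *: delta_mx 1 0)).
Proof.
rewrite /dirac /tens_block map_mxD !map_mxZ !map_delta_mx /= conjCK.
by rewrite !tensmxZr.
Qed.

Lemma Jconj_tens_block p q r s :
  Jconj (tens_block p q r s) =
  tens_block (map_mx Num.conj s) (map_mx Num.conj r)
             (map_mx Num.conj q) (map_mx Num.conj p).
Proof.
rewrite Jconj_block /tens_block block_mxKul block_mxKur block_mxKdl block_mxKdr.
by rewrite !map_mxT !map_mx1 !map_delta_mx.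
Qed.

Lemma delta00_Xmx (x : Aev C) :
  (delta_mx 0 0 : 'M_2) *m Xmx x = lamR x *: delta_mx 0 0.
Proof.
by rewrite /Xmx mulmxDr -!scalemxAr mul_delta_mx mul_delta_mx_0 // scaler0 addr0.
Qed.

Lemma Xmx_delta00 (x : Aev C) :
  Xmx x *m (delta_mx 0 0 : 'M_2) = lamR x *: delta_mx 0 0.
Proof.
by rewrite /Xmx mulmxDl -!scalemxAl mul_delta_mx mul_delta_mx_0 // scaler0 addr0.
Qed.

(** The lower right block vanishes because s (x) 1 commutes with 1 (x) m. In the off-diagonal blocks
    e_11 X = X e_11 = lambda_R e_11, so X enters only through the scalar lambda_R. *)
Lemma pirep_commutator_tens_block (x y : Aev C) p q r s :
  pirep x *m commutator (tens_block p q r s) (pirep y) =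
  tens_block (Xmx x *m (p *m Xmx y - Xmx y *m p))
    (q *m (lamR x *: (mpart y - (lamR y)%:M)))
    ((mpart x *m ((lamR y)%:M - mpart y)) *m r) 0.
Proof.
rewrite /commutator /pirep /tens_block !mulmx_block !mulmx0 !mul0mx.
rewrite !addr0 !add0r !tensmx_mul !mulmx1 !mul1mx opp_block_mx add_block_mx.
rewrite mulmx_block !mul0mx !addr0 !add0r subrr mulmx0.
(* The scalars lambda_R are moved to the right tensor factor, so that both terms of each
   off-diagonal block share the left factor e_11 and can be merged. *)
rewrite delta00_Xmx Xmx_delta00 !tensmxZl -!tensmxZr -tensmxNl -!tensmxNr.
rewrite -!tensmxDl -!tensmxDr !tensmx_mul !mul1mx Xmx_delta00 tensmxZl -tensmxZr.
rewrite tens0mx; congr (block_mx _ (_ *t _) (_ *t _) _).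
  by rewrite -scalemxAr mulmxBr mul_mx_scalar.
by rewrite -mulmxA mulmxBl mul_scalar_mx.
Qed.

End BlockShape.

(** * Blocks of the fluctuated operator and the constraints imposed by self-adjointness *)

Section FluctuatedBlocks.
Context {C : numClosedFieldType} {n : nat}.
Variables (kx ky : C) (a b : 'I_n -> Aev C).

Definition Xfluct (p : 'M[C]_2) : 'M[C]_2 :=
  \sum_j Xmx (a j) *m (p *m Xmx (b j) - Xmx (b j) *m p).
Definition Vfluct : 'M[C]_2 :=
  \sum_j mpart (a j) *m ((lamR (b j))%:M - mpart (b j)).
Definition Wfluct : 'M[C]_2 :=
  \sum_j lamR (a j) *: (mpart (b j) - (lamR (b j))%:M).

Lemma sum_pirep_commutator p q r s :
  \sum_j pirep (a j) *m commutator (tens_block p q r s) (pirep (b j)) =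
  tens_block (Xfluct p) (q *m Wfluct) (Vfluct *m r) 0.
Proof.
under eq_bigr do rewrite pirep_commutator_tens_block.
by rewrite tens_block_sum -mulmx_sumr -mulmx_suml big1_eq.
Qed.

Let K : 'M[C]_2 := kx *: delta_mx 0 1 + kx^* *: delta_mx 1 0.
Let Rblock : 'M[C]_2 :=
  (1%:M + Vfluct) *m (ky *: delta_mx 0 0) *m (1%:M + map_mx Num.conj Wfluct).

Lemma Xfluct0 : Xfluct 0 = 0.
Proof. by apply: big1 => j _; rewrite mul0mx mulmx0 subrr mulmx0. Qed.

(** With r = k_y e_11, the terms D, [A1], [Jconj A1] and [A2] contribute r, V r, r conj(W) and V r
    conj(W) to the lower left block, whose sum factors as [Rblock]. [A2] adds nothing to the
    diagonal blocks: [A1] has zero lower right block, so [Jconj A1] has zero upper left block. *)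
Lemma fluctuated_diracE :
  fluctuated_dirac kx ky a b =
  tens_block (K + Xfluct K) (map_mx Num.conj Rblock) Rblock
             (map_mx Num.conj (K + Xfluct K)).
Proof.
have conjmxK (M : 'M[C]_2) : map_mx Num.conj (map_mx Num.conj M) = M.
  by apply/matrixP=> i j; rewrite !mxE /= conjCK.
have A1E : A1 kx ky a b = tens_block (Xfluct K) (ky^* *: delta_mx 0 0 *m Wfluct)
    (Vfluct *m (ky *: delta_mx 0 0)) 0.
  by rewrite /A1 diracE sum_pirep_commutator.
rewrite /fluctuated_dirac /A2 A1E Jconj_tens_block diracE sum_pirep_commutator.
rewrite !tens_blockD !map_mx0 Xfluct0 !addr0 -/K.
rewrite -map_mxD /Rblock; congr tens_block; rewrite !(map_mxM, map_mxD, map_mxZ).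
  rewrite conjmxK map_delta_mx map_mx1 /= mulmxDr mulmx1 mulmxDl mul1mx.
  by rewrite mulmxDl addrACA !addrA.
rewrite map_delta_mx /= conjCK mulmxDr mulmx1 mulmxDl mul1mx.
by rewrite mulmxDl mulmxA !addrA.
Qed.

Hypothesis selfadj : let A := \sum_j lact (a j) (delta (b j)) in Tstar A = A.

(** Pairing with lambda_R on the left and the matrix entry (0, J) on the right gives the first row
    of W on one side; on the other, the transpose in the involution of M_2 turns the row into the
    first column of V, conjugated. *)
Lemma Wfluct_row0 J : (Wfluct 0 J)^* = Vfluct J 0.
Proof.
have := selfadjoint_pairing (@lamR C) (mentry 0 J) selfadj.
have -> : \sum_j (lamR (a j) * mentry 0 J (b j)
                  - lamR (a j * b j) * mentry 0 J 1) = Wfluct 0 J.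
  rewrite summxE; apply: eq_bigr => j _.
  by rewrite /mentry /mpart /lamR /= !mxE mulrBr mulr_natr mulrnAr.
move->; rewrite rmorph_sum summxE; apply: eq_bigr => j _.
rewrite mulmxBr mul_mx_scalar /= /Astar /mentry /lamR /mpart /= mul1r.
by rewrite rmorphB rmorphM /= !mxE !conjCK.
Qed.

Lemma lamL_lamR_conj :
  \sum_j lamL (a j) * (lamR (b j) - lamL (b j)) =
  (\sum_j lamR (a j) * (lamL (b j) - lamR (b j)))^*.
Proof.
have := selfadjoint_pairing (@lamL C) (@lamR C) selfadj => /= E.
rewrite rmorph_sum /=; under [RHS]eq_bigr do rewrite mulrBr rmorphB !rmorphM /=.
transitivity (\sum_j (lamL (a j) * lamR (b j) - lamL (a j * b j) * lamR 1)).
  by apply: eq_bigr => j _; rewrite mulr1 mulrBr.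
rewrite E; apply: eq_bigr => j _.
by rewrite mul1r /lamL /lamR /= rmorphM /= mulrC.
Qed.

(** Since X is diagonal, the (al, be) entry of X_a [p, X_b] is p_(al, be) times (X_a)_al ((X_b)_be -
    (X_b)_al), which vanishes for al = be. *)
Lemma XfluctE (p : 'M[C]_2) al be :
  Xfluct p al be =
  kron al 0 * kron be 1 * (p 0 1 * \sum_j lamR (a j) * (lamL (b j) - lamR (b j)))
  + kron al 1 * kron be 0 *
      (p 1 0 * \sum_j lamL (a j) * (lamR (b j) - lamL (b j))).
Proof.
have I2 (i : 'I_2) : i = 0 \/ i = 1.
  by case: i => [[|[|//]] ?]; [left | right]; apply: val_inj.
have XE x : Xmx x = diag_mx (\row_i if i == 0 then lamR x else lamL x) :> 'M[C]_2.
  apply/matrixP => i j; rewrite !mxE.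
  by case: (I2 i) => ->; case: (I2 j) => ->;
    rewrite /= ?mulr0 ?mulr1 ?addr0 ?add0r.
have -> : Xfluct p al be = \sum_j Xmx (a j) al al *
    (p al be * (Xmx (b j) be be - Xmx (b j) al al)).
  rewrite summxE; apply: eq_bigr => j _.
  rewrite !XE mul_diag_mx mul_mx_diag mul_diag_mx !mxE !eqxx !mulr1n.
  by rewrite [_ * p al be]mulrC -mulrBr.
rewrite !mulr_sumr -big_split /=; apply: eq_bigr => j _.
rewrite /kron !XE !mxE !eqxx.
case: (I2 al) => ->; case: (I2 be) => -> /=;
  by rewrite ?subrr ?(mulr0, mul0r, mul1r, addr0, add0r, mulr1n) // mulrCA.
Qed.

End FluctuatedBlocks.

(** * Entries of the four blocks *)

Section BlockEntries.
Context {C : numClosedFieldType}.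
Variables (p q r s : 'M[C]_2) (al I be J : 'I_2).

Lemma entryUU_tens_block :
  entryUU (tens_block p q r s) al I be J = p al be * kron I J.
Proof. by rewrite /entryUU block_mxKul tensmxE mxE. Qed.

Lemma entryUP_tens_block :
  entryUP (tens_block p q r s) al I be J = kron al 0 * kron be 0 * q I J.
Proof. by rewrite /entryUP block_mxKur tensmxE mxE -natrM mulnb. Qed.

Lemma entryPU_tens_block :
  entryPU (tens_block p q r s) al I be J = kron al 0 * kron be 0 * r I J.
Proof. by rewrite /entryPU block_mxKdl tensmxE mxE -natrM mulnb. Qed.

Lemma entryPP_tens_block :
  entryPP (tens_block p q r s) al I be J = s al be * kron I J.
Proof. by rewrite /entryPP block_mxKdr tensmxE mxE. Qed.

End BlockEntries.

Theorem proposition8 (R : realType) (kx ky : R[i])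
    (A : Atens R[i]) (n : nat) (a b : 'I_n -> Aev R[i])
    (A_oneform : A = \sum_(j < n) lact (a j) (delta (b j)))
    (A_selfadjoint : Tstar A = A)
    (phi : R[i]) (sigma : 'I_2 -> R[i])
    (phiE : phi = \sum_(j < n) lamR (a j) * (lamL (b j) - lamR (b j)))
    (sigmaE : forall I : 'I_2, sigma I =
       \sum_(j < n) (mpart (a j) I 0 * lamR (b j)
                     - \sum_(K < 2) mpart (a j) I K * mpart (b j) K 0)) :
  let D' := fluctuated_dirac kx ky a b in
  [/\ forall al I be J : 'I_2,
        entryUU D' al I be J =
          (kron al 0 * kron be 1 * (kx * (1 + phi))
           + kron al 1 * kron be 0 * (kx^* * (1 + phi^*))) * kron I J,
      forall al I be J : 'I_2,
        entryPU D' al I be J =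
          kron al 0 * kron be 0 * (kron I 0 + sigma I) * (kron J 0 + sigma J)
          * ky,
      forall al I be J : 'I_2,
        entryPP D' al I be J = (entryUU D' al I be J)^*
    & forall al I be J : 'I_2,
        entryUP D' al I be J = (entryPU D' al I be J)^*].
Proof.
have kron_conj (i j : 'I_2) : (kron i j : R[i])^* = kron i j by exact: rmorph_nat.
have selfadj := A_selfadjoint; rewrite A_oneform in selfadj.
have sigmaV I : Vfluct a b I 0 = sigma I.
  rewrite sigmaE summxE; apply: eq_bigr => j _.
  by rewrite mulmxBr mul_mx_scalar !mxE mulrC.
move=> D'; rewrite /D' fluctuated_diracE; split=> al I be J.
- rewrite entryUU_tens_block mxE XfluctE lamL_lamR_conj // -phiE !mxE /=.
  by rewrite /kron -!mulnb !natrM; ring.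
- rewrite entryPU_tens_block -scalemxAr -scalemxAl.
  (* Writing e_11 as a column times a row, through an index type of size 1, exhibits the block as
     the first column of 1 + V times the first row of 1 + conj(W). *)
  rewrite -[delta_mx 0 0](mul_delta_mx (0 : 'I_1)) mulmxA.
  rewrite -(mulmxA _ _ (1%:M + _)).
  rewrite -colE -rowE mxE mxE big_ord1 !mxE sigmaV.
  rewrite Wfluct_row0 // sigmaV (eq_sym 0) /kron; ring.
- by rewrite entryPP_tens_block entryUU_tens_block [in LHS]mxE rmorphM /= kron_conj.
- rewrite entryUP_tens_block entryPU_tens_block [in LHS]mxE !rmorphM /=.
  by rewrite !kron_conj.
Qed.
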